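(* Let $A\in\mathbb{C}^{n\times n}$ be normal, and let $\theta\in\mathbb{C}$ with $|\theta|=1$ and $\pi(x)=r_0+r_1x+r_2x^2$ with $r_0,r_1,r_2\in\mathbb{R}$, $r_2>0$, be such that $\sigma(A)\subset\mathcal{C}\cup\mathcal{C}_+$, where $\mathcal{C}$ is the image of $$q:\mathbb{R}\to\mathbb{C}:\quad \rho\mapsto\theta\rho+i\theta\pi(\rho).$$ Let $p$ be the number of eigenvalues of $A$ in $\mathcal{C}_+$. Then there exist normal $p$-augmentations $A_+$ of $A$ such that $$\sigma(A_+)\subset\mathcal{C}.$$
   Context: $\sigma(\cdot)$ denotes the spectrum; eigenvalues are counted with multiplicity. $\mathcal{C}_+$ is the open part of $\mathbb{C}$ on the convex side of the rotated parabola $\mathcal{C}$, i.e. $\mathcal{C}_+=\{\theta\rho+i\theta\tau:\rho,\tau\in\mathbb{R},\ \tau>\pi(\rho)\}$. A $p$-augmentation of $A\in\mathbb{C}^{n\times n}$ is a matrix $A_+=\begin{bmatrix} A & V \\ W^* & Y \end{bmatrix}\in\mathbb{C}^{(n+p)\times(n+p)}$ with $V,W\in\mathbb{C}^{n\times p}$ and $Y\in\mathbb{C}^{p\times p}$ (for $p=0$, $A_+=A$). *)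

(* Defs.v *)
From mathcomp Require Import all_boot all_order all_algebra.
From mathcomp Require Import spectral sesquilinear.
From mathcomp Require Import boolp classical_sets reals.
From mathcomp Require Import complex.

Set Implicit Arguments.
Unset Strict Implicit.
Unset Printing Implicit Defensive.

Import Order.TTheory GRing.Theory Num.Theory.
Local Open Scope ring_scope.
Local Open Scope complex_scope.
Local Open Scope sesquilinear_scope.
Local Open Scope classical_set_scope.

Section Parabola.
Variable R : realType.
Variables (theta : R[i]) (r0 r1 r2 : R).

Definition quad (x : R) : R := r0 + r1 * x + r2 * x ^+ 2.

Definition qcurve (rho : R) : R[i] :=
  theta * rho%:C + 'i%C * theta * (quad rho)%:C.

Definition parabola : set R[i] := range qcurve.

Definition parabola_plus : set R[i] :=
  [set z | exists rho tau : R,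
     z = theta * rho%:C + 'i%C * theta * tau%:C /\ quad rho < tau].

End Parabola.

Section Matrices.
Variables (R : realType) (n : nat).

Definition spectrum (A : 'M[R[i]]_n) : set R[i] := [set a | eigenvalue A a].

(* The roots of the characteristic polynomial, listed with their algebraic
   multiplicities; the order of the list is arbitrary. *)
Definition eigenvalues (A : 'M[R[i]]_n) : seq R[i] :=
  sval (closed_field_poly_normal (char_poly A)).

Lemma char_poly_eigenvalues (A : 'M[R[i]]_n) :
  char_poly A = \prod_(a <- eigenvalues A) ('X - a%:P).
Proof.
rewrite /eigenvalues; case: closed_field_poly_normal => s /= {1}->.
by rewrite (monicP (char_poly_monic A)) scale1r.
Qed.

Definition num_eigenvalues_in (A : 'M[R[i]]_n) (S : set R[i]) : nat :=
  count (fun a => a \in S) (eigenvalues A).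

Definition augmentation (p : nat) (A : 'M[R[i]]_n)
    (V W : 'M[R[i]]_(n, p)) (Y : 'M[R[i]]_p) : 'M[R[i]]_(n + p) :=
  block_mx A V (W^t*) Y.

End Matrices.

(* Main.v *)
(** Write [A = theta (H + i K)] with [H], [K] commuting Hermitian matrices. A
    matrix of the form [theta (H' + i pi(H'))] with [H'] Hermitian is normal and
    has its spectrum on the parabola. For [H' = [[H, V]; [V^*, 0]]] its upper left
    block is [theta (H + i (pi(H) + r2 V V^* ))], which equals [A] as soon as
    [V V^* = (K - pi(H)) / r2]. The right-hand side is positive semidefinite and
    its rank is the number of eigenvalues of [A] strictly inside the parabola, so
    it has such a factorization with [V] of size [n * p]. *)
Require Import Defs.
From mathcomp Require Import all_boot all_order all_algebra.
From mathcomp Require Import spectral sesquilinear.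
From mathcomp Require Import boolp classical_sets reals.
From mathcomp Require Import complex.
From mathcomp Require Import ring.

Import Order.TTheory GRing.Theory Num.Theory.
Local Open Scope ring_scope.
Local Open Scope classical_set_scope.
Local Open Scope sesquilinear_scope.

Set Implicit Arguments.
Unset Strict Implicit.

Lemma trmxC_mul (C : numClosedFieldType) m n p
    (A : 'M[C]_(m, n)) (B : 'M[C]_(n, p)) : (A *m B)^t* = B^t* *m A^t*.
Proof. by rewrite trmx_mul map_mxM. Qed.

Lemma unitary_diag_normal (C : numClosedFieldType) n (P : 'M[C]_n)
    (d : 'rV[C]_n) :
  P \is unitarymx -> P^t* *m diag_mx d *m P \is normalmx.
Proof.
move=> Pu; apply/normalmxP; rewrite !trmxC_mul trmxCK !mulmxA !(mulmxtVK _ Pu).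
rewrite tr_diag_mx map_diag_mx -!(mulmxA _ (diag_mx _) (diag_mx _)) !mulmx_diag.
by congr (_ *m diag_mx _ *m _); apply/rowP => i; rewrite !mxE mulrC.
Qed.

Lemma normal_spectralE (C : numClosedFieldType) n (A : 'M[C]_n) :
  A \is normalmx ->
  A = (spectralmx A)^t* *m diag_mx (spectral_diag A) *m spectralmx A.
Proof.
by move=> /orthomx_spectralP; rewrite -invmx_unitary ?spectral_unitarymx.
Qed.

(** Conjugation by [P] carries over to the characteristic matrix; the determinants of [P] and its
    adjoint cancel, and a diagonal matrix is triangular. *)
Lemma char_poly_unitary_diag (C : numClosedFieldType) n (P : 'M[C]_n)
    (d : 'rV[C]_n) :
  P \is unitarymx ->
  char_poly (P^t* *m diag_mx d *m P) =
    \prod_(a <- [seq d 0 i | i : 'I_n]) ('X - a%:P).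
Proof.
move=> Pu; have PtP : P^t* *m P = 1%:M by apply/mulmx1C/unitarymxP.
have cE : char_poly_mx (P^t* *m diag_mx d *m P) =
    map_mx polyC (P^t* ) *m char_poly_mx (diag_mx d) *m map_mx polyC P.
  rewrite /char_poly_mx mulmxBr mulmxBl -!map_mxM; congr (_ - _).
  by rewrite scalar_mxC -mulmxA -map_mxM PtP map_mx1 mulmx1.
rewrite /char_poly cE !det_mulmx mulrC mulrA -det_mulmx -map_mxM.
rewrite (unitarymxP Pu) map_mx1 det1 mul1r -/(char_poly _).
rewrite char_poly_trig ?diag_mx_is_trig // big_image.
by apply: eq_bigr => i _; rewrite mxE eqxx mulr1n.
Qed.

Lemma eigenvalue_unitary_diag (C : numClosedFieldType) n (P : 'M[C]_n)
    (d : 'rV[C]_n) (a : C) :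
  P \is unitarymx ->
  eigenvalue (P^t* *m diag_mx d *m P) a = (a \in [seq d 0 i | i : 'I_n]).
Proof.
move=> Pu; rewrite eigenvalue_root_char.
by rewrite char_poly_unitary_diag ?root_prod_XsubC.
Qed.

(** The columns of [S] are indexed by the nonzero entries of [g], the column of index [k] being the
    square root of that entry times the [k]-th basis vector. This keeps the width at the rank [p]
    instead of [n]. *)
Lemma gram_diag_mx (C : numClosedFieldType) n p (g : 'rV[C]_n) :
  (forall i, 0 <= g 0 i) -> p = #|[pred i | g 0 i != 0]| ->
  exists S : 'M[C]_(n, p), S *m S^t* = diag_mx g.
Proof.
move=> g_ge0 ->; exists (\matrix_(i, k) (sqrtC (g 0 i) *+ (i == enum_val k))).
apply/matrixP => i j; rewrite !mxE.
under eq_bigr => k _ do rewrite !mxE.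
rewrite -(big_enum_val (A := [pred i | g 0 i != 0]) (fun k =>
  sqrtC (g 0 i) *+ (i == k) * (sqrtC (g 0 j) *+ (j == k))^* )) /=.
(* Only [k = i] can contribute, and only on the diagonal [i = j]. *)
rewrite (eq_bigr (fun k => if k == i then g 0 i *+ (i == j) else 0)); last first.
  move=> k _; rewrite [k == i]eq_sym; have [<-|_] := eqVneq i k;
    last by rewrite mul0r.
  have [<-|_] := eqVneq j i; last by rewrite rmorph0 mulr0.
  by rewrite geC0_conj ?sqrtC_ge0 // -expr2 sqrtCK.
(* If [g 0 i] vanishes, no column has index [i], but the entry to produce is also zero. *)
rewrite -big_mkcondr /=; have [gi0|gi0] := eqVneq (g 0 i) 0.
  by rewrite gi0 mul0rn big1.
rewrite (big_pred1 i) // => k /=.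
by rewrite inE; have [->|] := eqVneq k i; rewrite ?gi0 ?andbF.
Qed.

Section QuadMx.
Variables (C : numClosedFieldType) (a b c : C).

(** Complex coefficients let [theta] and ['i] be absorbed, so that this one form covers X -> theta
    (X + i pi(X)). *)
Definition quad_mx n (X : 'M[C]_n) : 'M[C]_n := a%:M + b *: X + c *: (X *m X).

Lemma quad_mx_unitary_diag n (P : 'M[C]_n) (d : 'rV[C]_n) :
  P \is unitarymx ->
  quad_mx (P^t* *m diag_mx d *m P) =
    P^t* *m diag_mx (\row_i (a + b * d 0 i + c * d 0 i ^+ 2)) *m P.
Proof.
move=> Pu; have PtP : P^t* *m P = 1%:M by apply/mulmx1C/unitarymxP.
rewrite /quad_mx !mulmxA (mulmxtVK _ Pu).
rewrite -(mulmxA _ (diag_mx d) (diag_mx d)) mulmx_diag.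
rewrite -[a%:M]mulmx1 -PtP mulmxA -scalar_mxC.
rewrite [b *: _]scalemxAl [c *: _]scalemxAl -!mulmxDl.
rewrite [b *: _]scalemxAr [c *: _]scalemxAr -!mulmxDr.
congr (_ *m _ *m _); apply/matrixP => i j; rewrite !mxE.
by rewrite expr2; case: eqVneq => [->|]; rewrite ?mulr0n ?mulr0 ?addr0.
Qed.

Lemma ulsubmx_quad_mx n p (H : 'M[C]_n) (V : 'M[C]_(n, p)) W Y :
  ulsubmx (quad_mx (block_mx H V W Y)) = quad_mx H + c *: (V *m W).
Proof.
rewrite /quad_mx mulmx_block !scale_block_mx scalar_mx_block !add_block_mx.
by rewrite block_mxKul scalerDr addrA.
Qed.

End QuadMx.

Lemma hermsymmxP (C : numClosedFieldType) n (H : 'M[C]_n) :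
  reflect (H^t* = H) (H \is hermsymmx).
Proof. by apply: (iffP (is_hermitianmxP _ _ _)); rewrite expr0 scale1r. Qed.

Lemma unitary_diag_hermsym (C : numClosedFieldType) n (P : 'M[C]_n)
    (d : 'rV[C]_n) :
  (forall i, d 0 i \is Num.real) -> P^t* *m diag_mx d *m P \is hermsymmx.
Proof.
move=> dR; apply/hermsymmxP; rewrite !trmxC_mul trmxCK mulmxA.
rewrite tr_diag_mx map_diag_mx; congr (_ *m diag_mx _ *m _).
by apply/rowP => i; rewrite mxE; apply/CrealP.
Qed.

Lemma block_hermsym (C : numClosedFieldType) n p (H : 'M[C]_n)
    (V : 'M[C]_(n, p)) :
  H \is hermsymmx -> block_mx H V (V^t* ) 0 \is hermsymmx.
Proof.
move=> /hermsymmxP hH; apply/hermsymmxP.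
by rewrite tr_block_mx map_block_mx hH trmxCK trmx0 map_mx0.
Qed.

Section ParabolaCoordinates.
Local Open Scope complex_scope.
Variables (R : realType) (theta : R[i]) (r0 r1 r2 : R).
Hypothesis theta1 : `|theta| = 1.

Lemma qcurve_quadratic (x : R) :
  qcurve theta r0 r1 r2 x =
    'i%C * theta * r0%:C + (theta + 'i%C * theta * r1%:C) * x%:C +
    'i%C * theta * r2%:C * x%:C ^+ 2.
Proof. by rewrite /qcurve /quad !rmorphD !rmorphM /=; ring. Qed.

(** As [theta] has modulus 1, its conjugate is its inverse. *)
Lemma rotated_coordinates (z : R[i]) : let w := (theta^* )%R * z in
  z = theta * (complex.Re w)%:C + 'i%C * theta * (complex.Im w)%:C.
Proof.
rewrite /= -[_ * theta]mulrC -mulrA -mulrDr -complexE mulrA.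
by rewrite -normCK theta1 expr1n mul1r.
Qed.

Lemma rotated_coordinates_inj (x t y s : R) :
  theta * x%:C + 'i%C * theta * t%:C = theta * y%:C + 'i%C * theta * s%:C ->
  x = y /\ t = s.
Proof.
have theta0 : theta != 0 by rewrite -normr_gt0 theta1.
rewrite -[_ * theta]mulrC -!mulrA -!mulrDr => /(mulfI theta0).
by simpc => -[-> ->].
Qed.

(** Signed height of [z] above the parabola in the rotated frame; at the eigenvalues of A it gives
    the eigenvalues of K - pi(H). *)
Definition gap (z : R[i]) : R :=
  complex.Im ((theta^* )%R * z) - quad r0 r1 r2 (complex.Re ((theta^* )%R * z)).

Lemma gapE (x t : R) :
  gap (theta * x%:C + 'i%C * theta * t%:C) = t - quad r0 r1 r2 x.
Proof.
have /esym/rotated_coordinates_inj[xE tE] := rotated_coordinates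
  (theta * x%:C + 'i%C * theta * t%:C).
by rewrite /gap xE tE.
Qed.

Lemma gap_eq0 z : parabola theta r0 r1 r2 z -> gap z = 0.
Proof. by case=> x _ <-; rewrite gapE subrr. Qed.

Lemma gap_gt0 z : parabola_plus theta r0 r1 r2 z <-> 0 < gap z.
Proof.
split=> [[x [t [-> lt_t]]]|]; first by rewrite gapE subr_gt0.
rewrite subr_gt0 => zgt; do 2 eexists; split; last exact: zgt.
exact: rotated_coordinates.
Qed.

End ParabolaCoordinates.

Lemma eigenvalues_unitary_diag (R : realType) n (P : 'M[R[i]]_n)
    (d : 'rV[R[i]]_n) :
  P \is unitarymx ->
  perm_eq (eigenvalues (P^t* *m diag_mx d *m P)) [seq d 0 i | i : 'I_n].
Proof.
move=> Pu; apply: prod_XsubC_eq.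
by rewrite -char_poly_eigenvalues char_poly_unitary_diag.
Qed.

Unset Implicit Arguments.
Set Strict Implicit.

Theorem theorem5p7 (R : realType) (n : nat) (A : 'M[R[i]]_n)
    (theta : R[i]) (r0 r1 r2 : R) (p : nat) :
  A \is normalmx ->
  `|theta| = 1 ->
  0 < r2 ->
  spectrum A `<=` parabola theta r0 r1 r2 `|` parabola_plus theta r0 r1 r2 ->
  p = num_eigenvalues_in A (parabola_plus theta r0 r1 r2) ->
  exists (V W : 'M[R[i]]_(n, p)) (Y : 'M[R[i]]_p),
    augmentation A V W Y \is normalmx /\
    spectrum (augmentation A V W Y) `<=` parabola theta r0 r1 r2.
Proof.
move=> A_normal theta1 r2_gt0 spA pE.
have Pu := spectral_unitarymx A; have AE := normal_spectralE A_normal.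
move: (spectralmx A) (spectral_diag A) => P d in Pu AE.
pose rho i := complex.Re ((theta^* )%R * d 0 i).
pose g i := gap theta r0 r1 r2 (d 0 i).
have g_ge0 i : 0 <= g i.
  have /spA[dpar|/(gap_gt0 _ _ _ theta1)/ltW//] : spectrum A (d 0 i).
    by rewrite /spectrum /= AE eigenvalue_unitary_diag // fintype.image_f.
  by rewrite /g (gap_eq0 theta1 dpar).
have pE' : p = #|[pred i | (\row_i (g i / r2)%:C%C : 'rV[R[i]]_n) 0 i != 0]|.
  rewrite pE /num_eigenvalues_in AE (permP (eigenvalues_unitary_diag d Pu)).
  rewrite count_map -sum1_count big_enum_cond /= sum1_card.
  apply: eq_card => i; rewrite !inE /= mxE.
  rewrite fmorph_eq0 mulf_eq0 invr_eq0 (gt_eqF r2_gt0) orbF.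
  (* Since [g i] is nonnegative, being nonzero is the same as being positive, that is, as [d 0 i]
     lying strictly inside the parabola. *)
  rewrite unfold_in /= -[RHS]andbT -(g_ge0 i) -lt0r.
  by apply/asboolP/idP => /(gap_gt0 _ _ _ theta1).
have [i|S SE] := gram_diag_mx _ pE'.
  by rewrite mxE ler0c divr_ge0 // ltW.
(* Hence V V^* is diagonal in the eigenbasis of [A], with entries [g i / r2]; [H] below is the
   Hermitian part of A / theta. *)
pose V := P^t* *m S.
pose H := P^t* *m diag_mx (\row_i (rho i)%:C%C) *m P.
pose Hp := block_mx H V (V^t* ) 0.
have Hp_herm : Hp \is hermsymmx.
  apply/block_hermsym/unitary_diag_hermsym => i; rewrite mxE.
  by apply/complex_realP; exists (rho i).
have hR := hermitian_spectral_diag_real Hp_herm.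
have Ppu := spectral_unitarymx Hp.
have HpE := normal_spectralE (hermitian_normalmx Hp_herm).
(* By [qcurve_quadratic] these coefficients make [Q] equal to theta (Hp + i pi(Hp)). *)
pose Q := quad_mx ('i * theta * r0%:C)%C (theta + 'i * theta * r1%:C)%C
  ('i * theta * r2%:C)%C Hp.
have QulE : ulsubmx Q = A.
  rewrite ulsubmx_quad_mx quad_mx_unitary_diag // /V trmxC_mul trmxCK.
  rewrite mulmxA -(mulmxA _ S) SE AE scalemxAl scalemxAr -mulmxDl -mulmxDr.
  congr (_ *m _ *m _).
  rewrite -linearZ -linearD /=; congr diag_mx.
  apply/rowP => i; rewrite !mxE -qcurve_quadratic.
  rewrite [RHS](rotated_coordinates theta1 _) /qcurve /g /gap.
  (* The factor [r2] cancels, and [g i] lifts pi(rho i) to the second rotated coordinate of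
     [d 0 i]. *)
  rewrite -addrA -[_ * r2%:C%C * _]mulrA -rmorphM /= [r2 * _]mulrC.
  rewrite divfK ?gt_eqF //.
  by rewrite -mulrDr -rmorphD /= subrKC.
(* The augmentation is [Q] itself, cut into blocks; the lower left one is conjugate-transposed
   because [augmentation] does so to [W]. *)
exists (ursubmx Q), ((dlsubmx Q)^t*), (drsubmx Q).
rewrite /augmentation trmxCK -QulE submxK /Q [in quad_mx _ _ _ _]HpE.
rewrite quad_mx_unitary_diag //; split.
  exact: unitary_diag_normal.
(* Each eigenvalue of [Q] is the curve point at an eigenvalue of [Hp], which is real because [Hp] is
   Hermitian. *)
move=> a; rewrite /spectrum /= eigenvalue_unitary_diag //
  => /fintype.imageP[i _ ->]; have /complex_realP[x hE] := mxOverP hR 0 i.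
by exists x => //; rewrite mxE hE qcurve_quadratic.
Qed.
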